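(* Let $b:=(b_1,0)\in\mathbb{R}^2$ with $b_1>0$ and let \[ c=(c_k)_{k\in\mathbb{N}}=(u+\beta_0,\ u+v+\beta_1,\ \ldots,\ ku+v+\beta_k,\ \ldots)\in\mathbb{R}^{\mathbb{N}} \] (that is, $c_0=u+\beta_0$ and $c_k=ku+v+\beta_k$ for $k\ge1$) with $(u,v)\in\mathbb{R}^2$ and $(\beta_k)_{k\in\mathbb{N}}\in\mathbb{R}_+^{\mathbb{N}}$; hence $(c,b)\in\Lambda$. Set $\overline{\beta}:=\liminf_{k\to\infty}\beta_k/k\in[0,\infty]$ and $\overline{u}:=u+\min\{\beta_0,\overline{\beta}\}$. Then $F(b)=\{b_1e_0\}$, and \[ \varphi(c,b)=b_1c_0,\qquad \psi(c,b)=b_1\overline{u},\qquad g(c,b)=b_1\max\{0,\beta_0-\overline{\beta}\}; \] moreover, $(u,v)$ is an optimal solution of $(PG^*_{c,b})$ if $\min\{\beta_0,\overline{\beta}\}=0$, and $(PG^*_{c,b})$ has optimal solutions if $0<\beta_0<\overline{\beta}$. Furthermore, if $\beta_0\ge\overline{\beta}>0$, then $(PG^*_{c,b})$ has optimal solutions if and only if $\inf\{\beta_k-\overline{\beta}k\mid k\ge1\}\in\mathbb{R}$.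
   Context: $\mathbb{N}=\{0,1,2,\ldots\}$ and $\mathbb{R}_+=[0,\infty[$. $X:=\mathbb{R}^{(\mathbb{N})}$ is the space of real sequences $(x_k)_{k\in\mathbb{N}}$ with only finitely many nonzero terms; its algebraic dual is identified with $\mathbb{R}^{\mathbb{N}}$ (all real sequences) via $\langle x,c\rangle=\sum_{k=0}^\infty x_kc_k$. $e_0:=(1,0,0,\ldots)$. $P:=\{x\in\mathbb{R}^{(\mathbb{N})}\mid x_k\ge0\ \forall k\}$, $Q:=\{0\}\subset\mathbb{R}^2$, and $A:\mathbb{R}^{(\mathbb{N})}\to\mathbb{R}^2$, $A(x):=\left(x_0+\sum_{k=1}^\infty kx_k,\ \sum_{k=1}^\infty x_k\right)$, with adjoint $A^*(y_1,y_2)=(y_1,\,y_1+y_2,\ldots,ky_1+y_2,\ldots)$. For $c\in\mathbb{R}^{\mathbb{N}}$ and $b=(b_1,b_2)\in\mathbb{R}^2$, the perturbed Gale problems are $(PG_{c,b})$: minimize $\langle x,c\rangle$ subject to $x\in P$, $Ax=b$, with feasible set $F(b)$ and value $\varphi(c,b)$ (infimum); $(PG^*_{c,b})$: maximize $b_1y_1+b_2y_2$ subject to $(y_1,y_2)\in\mathbb{R}^2$, $y_1\le c_0$, $ky_1+y_2\le c_k$ for all $k\ge1$, with feasible set $F^*(c)$ and value $\psi(c,b)$ (supremum). $\Lambda:=\{(c,b)\in\mathbb{R}^{\mathbb{N}}\times\mathbb{R}^2\mid F^*(c)\neq\emptyset,\ F(b)\neq\emptyset\}$ and $g(c,b):=\varphi(c,b)-\psi(c,b)$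 for $(c,b)\in\Lambda$ is the duality gap. *)

(* Defs.v *)
From mathcomp Require Import all_boot all_order all_algebra.
From mathcomp Require Import all_classical all_reals all_analysis.

Set Implicit Arguments.
Unset Strict Implicit.
Unset Printing Implicit Defensive.

Import Order.TTheory GRing.Theory Num.Theory.

Local Open Scope classical_set_scope.
Local Open Scope ring_scope.

Section Gale.
Variable R : realType.
Implicit Types (x c : nat -> R) (b y : R * R).

(* The space R^(N), as a subset of the space R^N of all sequences. *)
Definition fin_seqs : set (nat -> R) :=
  [set x | finite_set [set k | x k != 0]].

Definition e0 : nat -> R := fun k => (k == 0%N)%:R.

(* The sums over k \in D below are finitely supported sums: for x in fin_seqs
   they are the usual sums, but a sum with infinite support would evaluate to 0,
   so pairing and gale_op are only meaningful on fin_seqs. *)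
Definition pairing x c : R := \sum_(k \in [set: nat]) x k * c k.

Definition gale_op x : R * R :=
  (x 0%N + \sum_(k \in [set k | (1 <= k)%N]) k%:R * x k,
   \sum_(k \in [set k | (1 <= k)%N]) x k).

Definition gale_cone : set (nat -> R) :=
  [set x | fin_seqs x /\ forall k, 0 <= x k].

Definition primal_feasible b : set (nat -> R) :=
  [set x | gale_cone x /\ gale_op x = b].

Definition primal_value c b : \bar R :=
  ereal_inf [set (pairing x c)%:E | x in primal_feasible b].

Definition dual_feasible c : set (R * R) :=
  [set y | y.1 <= c 0%N /\ forall k, (1 <= k)%N -> k%:R * y.1 + y.2 <= c k].

Definition dual_objective b y : R := b.1 * y.1 + b.2 * y.2.

Definition dual_value c b : \bar R :=
  ereal_sup [set (dual_objective b y)%:E | y in dual_feasible c].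

Definition dual_optimal c b : set (R * R) :=
  [set y | dual_feasible c y /\
    forall y', dual_feasible c y' -> dual_objective b y' <= dual_objective b y].

Definition Lambda : set ((nat -> R) * (R * R)) :=
  [set cb | dual_feasible cb.1 !=set0 /\ primal_feasible cb.2 !=set0].

(* Only meaningful for (c, b) in Lambda, where both values are finite. *)
Definition duality_gap c b : \bar R := (primal_value c b - dual_value c b)%E.

End Gale.

Arguments e0 : clear implicits.
Arguments Lambda : clear implicits.

(* Main.v *)
Require Import Defs.
From mathcomp Require Import all_boot all_order all_algebra.
From mathcomp Require Import all_classical all_reals all_analysis.
From mathcomp Require Import ring lra.

Import Order.TTheory GRing.Theory Num.Theory.

Local Open Scope classical_set_scope.
Local Open Scope ring_scope.

(** The primal side is rigid and the dual side is a question about slopes.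

    The second row of A x = (b1, 0) says that the nonnegative numbers x_k,
    k >= 1, sum to 0, so they all vanish and the first row gives x_0 = b1: the
    only feasible point is b1 e_0 ([primal_feasible_ray]), whose cost is
    b1 c_0.

    The dual objective is b1 y_1, so y_2 matters only through feasibility.  The
    constraints k y_1 + y_2 <= c_k say that the affine function of k with slope
    y_1 and intercept y_2 minorizes c.  Hence y_1 extends to a feasible pair
    exactly when y_1 <= c_0 and c_k - k y_1 is bounded below ([dual_slopesP]).
    With y_1 = u + t this becomes t <= beta_0 and beta_k - k t bounded below
    ([affine_minorant_shift]).  Such a lower bound exists if
    t < liminf beta_k / k, since then beta_k - k t >= 0 for all large k
    ([lt_liminf_slope]); and it forces t <= liminf beta_k / k, since dividing it
    by k leaves an error that tends to 0 ([affine_minorant_le]).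

    So the admissible y_1 form a ray that is unbounded below, with supremum
    u + min(beta_0, betabar).  This gives the dual value ([dual_value_slopes]),
    and an optimal solution exists exactly when the ray contains its endpoint
    ([dual_optimal_neq0]).  The endpoint belongs to the ray if (u, v) realizes
    it or if beta_0 < betabar; if betabar <= beta_0, it belongs to the ray
    exactly when beta_k - betabar k is bounded below. *)

(** * The primal problem *)

(** A finitely supported sum of nonnegative terms dominates each of its terms.
    Finiteness of the support is essential, because a sum with infinite support
    evaluates to 0. *)
Lemma fsumr_eq0 {R : realDomainType} {I : choiceType} (P : set I) (F : I -> R) :
  finite_set [set i | F i != 0] -> (forall i, P i -> 0 <= F i) ->
  \sum_(i \in P) F i = 0 -> forall i, P i -> F i = 0.
Proof.
move=> finF F0 sumF0 i Pi; apply/eqP/negPn/negP => Fi_neq0.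
have finPF : finite_set (P `&` F @^-1` [set~ 0]).
  by apply: sub_finite_set finF => j [_ /= /eqP].
move: sumF0; rewrite fsbig_supp (fsbigD1 i)//=; last by split => //=; exact/eqP.
apply/eqP; rewrite gt_eqF// ltr_pwDl//.
  by rewrite lt_neqAle eq_sym Fi_neq0 F0.
by apply: fsumr_ge0 => j [[Pj _] _]; exact: F0.
Qed.

Lemma rayE {R : realType} (b1 : R) (k : nat) :
  (b1 *: e0 R) k = b1 * (k == 0%N)%:R.
Proof. by rewrite scalrfctE. Qed.

(** The second component of the operator is a sum of nonnegative coordinates,
    so its vanishing kills every coordinate but the first. *)
Lemma primal_feasible_ray {R : realType} (b1 : R) : 0 <= b1 ->
  primal_feasible (b1, 0) = [set b1 *: e0 R].
Proof.
move=> b1_ge0; apply/seteqP; split => [x [[finx x_ge0] [Ax1 Ax2]]|x ->]/=.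
  have x0 k : (1 <= k)%N -> x k = 0.
    exact: fsumr_eq0 finx (fun k _ => x_ge0 k) Ax2 k.
  apply/funext => -[|k]; rewrite rayE/=.
    rewrite -Ax1 fsbig1 ?addr0 ?mulr1// => k k_ge1.
    by rewrite x0 ?mulr0.
  by rewrite mulr0 x0.
have e00 k : (1 <= k)%N -> (b1 *: e0 R) k = 0.
  by case: k => // k _; rewrite rayE/= mulr0.
split; first split.
- apply: (@sub_finite_set _ _ [set 0%N]) => // -[//|k] /= /eqP.
  by rewrite e00.
- case=> [|k]; last by rewrite e00.
  by rewrite rayE/= mulr1.
- rewrite /gale_op !fsbig1 => [|k /e00//|k /e00 ->]; last by rewrite mulr0.
  by rewrite addr0 rayE/= mulr1.
Qed.

Lemma pairing_ray {R : realType} (b1 : R) (c : nat -> R) :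
  pairing (b1 *: e0 R) c = b1 * c 0%N.
Proof.
rewrite /pairing -(@fsbig_widen _ _ _ _ [set 0%N])// ?fsbig_set1.
  by rewrite rayE/= mulr1.
move=> -[[_ /(_ erefl)//]|k _] /=.
by rewrite rayE/= mulr0 mul0r.
Qed.

(** * Slopes of affine minorants and the lower limit of a_k / k *)

(** The slope t occurs in some affine function of k that lies below a on
    k >= 1; the intercepts of these functions are the lower bounds. *)
Definition affine_minorant {R : realType} (a : nat -> R) (t : R) : Prop :=
  has_lbound [set a k - k%:R * t | k in [set k | (1 <= k)%N]].

Definition liminf_slope {R : realType} (a : nat -> R) : \bar R :=
  limn_einf (fun k => (a k / k%:R)%:E).

Lemma limn_einf_sup_einfs {R : realType} (w : (\bar R)^nat) :
  limn_einf w = ereal_sup (range (einfs w)).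
Proof. by rewrite limn_einf_lim; apply/cvg_lim => //; exact: cvg_einfs_sup. Qed.

(** From some n on, a_k / k > t and the difference a_k - k t is nonnegative;
    the finitely many earlier differences have a minimum. *)
Lemma lt_liminf_slope {R : realType} (a : nat -> R) (t : R) :
  (t%:E < liminf_slope a)%E -> affine_minorant a t.
Proof.
rewrite /liminf_slope limn_einf_sup_einfs => /ereal_sup_gt[_ [n _ <-] t_lt].
exists (\big[Num.min/0]_(i < n) (a i - i%:R * t)) => _ [k k_ge1 <-].
have [k_lt|n_le] := ltnP k n.
  exact: (bigmin_le _ (Ordinal k_lt) (fun i : 'I_n => a i - i%:R * t)).
apply: (le_trans (bigmin_le_id _ _ _ _)).
have : (t%:E < (a k / k%:R)%:E)%E.
  by apply: (lt_le_trans t_lt); apply: ereal_inf_lbound; exists k.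
by rewrite lte_fin ltr_pdivlMr ?ltr0n// mulrC subr_ge0 => /ltW.
Qed.

(** If a_k - k t >= m, then a_k / k >= t + m / k, and m / k tends to 0. *)
Lemma affine_minorant_le {R : realType} (a : nat -> R) (t : R) :
  affine_minorant a t -> (t%:E <= liminf_slope a)%E.
Proof.
move=> [m m_le]; apply/lee_subgt0Pr => e e_gt0.
rewrite /liminf_slope limn_einf_sup_einfs.
(* For k >= n, the error m / k is at least - e. *)
pose n := (Num.truncn (- m / e)).+1.
apply: (@le_trans _ _ (einfs (fun k => (a k / k%:R)%:E) n)); last first.
  by apply: ereal_sup_ubound; exists n.
apply: le_ereal_inf_tmp => _ [k /= n_le_k <-].
have k_ge1 : (1 <= k)%N by exact: leq_trans n_le_k.
have /m_le mk : [set a k - k%:R * t | k in [set k | (1 <= k)%N]]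
    (a k - k%:R * t) by exists k.
have : - m / e < k%:R.
  by rewrite (lt_le_trans (truncnS_gt _))// ler_nat.
rewrite ltr_pdivrMr// => me.
rewrite -EFinB lee_fin ler_pdivlMr ?ltr0n//.
nra.
Qed.

Lemma affine_minorant_fin_num {R : realType} (a : nat -> R) (t : R) :
  affine_minorant a t <->
  ereal_inf [set (a k - k%:R * t)%:E | k in [set k | (1 <= k)%N]]
    \is a fin_num.
Proof.
rewrite -(image_comp (fun k => a k - k%:R * t) EFin).
split=> [lb|inf_fin].
  by rewrite ereal_inf_EFin//; exists (a 1%N - 1%:R * t), 1%N.
exists (fine (ereal_inf
  (EFin @` [set a k - k%:R * t | k in [set k | (1 <= k)%N]]))) => x Ax.
by rewrite -lee_fin fineK//; apply: ereal_inf_lbound; exists x.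
Qed.

(** * The dual problem as a problem about slopes *)

Definition dual_slopes {R : realType} (c : nat -> R) : set R :=
  [set y1 | exists y2, dual_feasible c (y1, y2)].

Lemma dual_slopesP {R : realType} (c : nat -> R) (y1 : R) :
  dual_slopes c y1 <-> y1 <= c 0%N /\ affine_minorant c y1.
Proof.
split=> [[y2 [/= y1_le y_le]]|[y1_le [m m_le]]].
  split=> //; exists y2 => _ [k k_ge1 <-].
  by rewrite lerBrDl; exact: y_le.
exists m; split=> //= k k_ge1.
by rewrite -lerBrDl; apply: m_le; exists k.
Qed.

(** The affine part k u + v of c only translates the slope and the lower
    bound. *)
Lemma affine_minorant_shift {R : realType} (a c : nat -> R) (u v t : R) :
  (forall k, (1 <= k)%N -> c k = k%:R * u + v + a k) ->
  affine_minorant c (u + t) <-> affine_minorant a t.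
Proof.
move=> cE; have shift k : (1 <= k)%N ->
    c k - k%:R * (u + t) = v + (a k - k%:R * t).
  by move=> /cE ->; ring.
split=> -[m m_le].
  exists (m - v) => _ [k k_ge1 <-].
  by rewrite lerBlDl -shift//; apply: m_le; exists k.
exists (v + m) => _ [k k_ge1 <-].
by rewrite shift// lerD2l; apply: m_le; exists k.
Qed.

(** The objective depends only on the slope, so the dual value is determined by
    the supremum of the admissible slopes, attained or not.  The two hypotheses
    say that these slopes form a ray with endpoint M, which they may or may not
    contain. *)
Lemma dual_value_slopes {R : realType} (b1 : R) (c : nat -> R) (M : R) :
  0 < b1 -> (forall s, dual_slopes c s -> s <= M) ->
  (forall s, s < M -> dual_slopes c s) ->
  dual_value c (b1, 0) = (b1 * M)%:E.
Proof.
move=> b1_gt0 slopes_le lt_slopes.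
apply/eqP; rewrite eq_le; apply/andP; split.
  apply: ge_ereal_sup => _ [[y1 y2] feas <-].
  rewrite lee_fin /dual_objective/= mul0r addr0 ler_pM2l//.
  by apply: slopes_le; exists y2.
apply/lee_subgt0Pr => e e_gt0.
have [|y2 feas] := lt_slopes (M - e / b1).
  by rewrite ltrBlDr ltrDl divr_gt0.
apply: ereal_sup_ubound; exists (M - e / b1, y2) => //.
rewrite /dual_objective/= -EFinB; congr EFin; field.
by rewrite gt_eqF.
Qed.

Lemma dual_optimal_slopes {R : realType} (b1 : R) (c : nat -> R) (M y2 : R) :
  0 < b1 -> (forall s, dual_slopes c s -> s <= M) ->
  dual_feasible c (M, y2) -> dual_optimal c (b1, 0) (M, y2).
Proof.
move=> b1_gt0 slopes_le feas; split=> // -[y1' y2'] feas'.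
rewrite /dual_objective/= !mul0r !addr0 ler_pM2l//.
by apply: slopes_le; exists y2'.
Qed.

(** An optimal slope is at least every s < M, hence equals the endpoint M. *)
Lemma dual_optimal_neq0 {R : realType} (b1 : R) (c : nat -> R) (M : R) :
  0 < b1 -> (forall s, dual_slopes c s -> s <= M) ->
  (forall s, s < M -> dual_slopes c s) ->
  dual_optimal c (b1, 0) !=set0 <-> dual_slopes c M.
Proof.
move=> b1_gt0 slopes_le lt_slopes.
split=> [[[y1 y2] [feas opt]]|[y2 feas]]; last first.
  by exists (M, y2); exact: dual_optimal_slopes.
suff -> : M = y1 by exists y2.
apply/eqP; rewrite eq_le (slopes_le y1) ?andbT; last by exists y2.
apply/ler_addgt0Pr => e e_gt0; rewrite -lerBlDr.
have [|y2' feas'] := lt_slopes (M - e); first by rewrite ltrBlDr ltrDl.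
have := opt _ feas'.
by rewrite /dual_objective/= !mul0r !addr0 ler_pM2l.
Qed.

(** * Values, duality gap and dual solutions *)

Theorem proposition8 (R : realType) (b1 : R) (hb1 : 0 < b1)
    (u v : R) (beta : nat -> R) (hbeta : forall k, 0 <= beta k)
    (c : nat -> R) (hc0 : c 0%N = u + beta 0%N)
    (hck : forall k, (1 <= k)%N -> c k = k%:R * u + v + beta k) :
  let b : R * R := (b1, 0) in
  let betabar : \bar R := limn_einf (fun k => (beta k / k%:R)%:E) in
  let ubar : \bar R := (u%:E + Order.min (beta 0%N)%:E betabar)%E in
  Lambda R (c, b) /\
  primal_feasible b = [set b1 *: e0 R] /\
  primal_value c b = (b1 * c 0%N)%:E /\
  dual_value c b = (b1%:E * ubar)%E /\
  duality_gap c b =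
    (b1%:E * Order.max 0 ((beta 0%N)%:E - betabar))%E /\
  (Order.min (beta 0%N)%:E betabar = 0%E -> dual_optimal c b (u, v)) /\
  ((0 < (beta 0%N)%:E)%E -> ((beta 0%N)%:E < betabar)%E ->
    dual_optimal c b !=set0) /\
  ((betabar <= (beta 0%N)%:E)%E -> (0 < betabar)%E ->
    (dual_optimal c b !=set0 <->
     ereal_inf [set ((beta k)%:E - betabar * k%:R%:E)%E
               | k in [set k | (1 <= k)%N]] \is a fin_num)).
Proof.
move=> b betabar ubar.
have betabar_ge0 : (0%:E <= betabar)%E.
  apply: affine_minorant_le; exists 0 => _ [k _ <-].
  by rewrite mulr0 subr0.
have feas_uv : dual_feasible c (u, v).
  split=> [|k k_ge1] /=; first by rewrite hc0 lerDl.
  by rewrite hck// lerDl.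
have primalE : primal_feasible b = [set b1 *: e0 R].
  by apply: primal_feasible_ray; exact: ltW.
have primal_valueE : primal_value c b = (b1 * c 0%N)%:E.
  by rewrite /primal_value primalE image_set1 ereal_inf1 pairing_ray.
(* The minimum is finite even if the lower limit is +oo, because it is at most
   beta 0; so the largest slope u + m is a real number. *)
have [m mE] : exists m, Order.min (beta 0%N)%:E betabar = m%:E.
  exists (fine (Order.min (beta 0%N)%:E betabar)); rewrite fineK//.
  rewrite fin_numE -!ltNye -!ltey; apply/andP; split.
    by rewrite lt_min ltNyr (lt_le_trans _ betabar_ge0) ?ltNyr.
  by rewrite gt_min ltry.
have slopesP t : dual_slopes c (u + t) <->
    t <= beta 0%N /\ affine_minorant beta t.
  by rewrite dual_slopesP hc0 lerD2l (affine_minorant_shift _ _ _ _ _ hck).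
have slopes_le s : dual_slopes c s -> s <= u + m.
  rewrite -[s](subrKC u) => /slopesP[le0 /affine_minorant_le le_bar].
  by rewrite lerD2l -lee_fin -mE le_min lee_fin le0.
have lt_slopes s : s < u + m -> dual_slopes c s.
  rewrite -[s](subrKC u) ltrD2l -lte_fin -mE lt_min => /andP[lt0 lt_bar].
  apply/slopesP; split; first by rewrite ltW.
  exact: lt_liminf_slope.
have dual_valueE : dual_value c b = (b1%:E * ubar)%E.
  rewrite (dual_value_slopes _ _ _ hb1 slopes_le lt_slopes).
  by rewrite /ubar mE -EFinD -EFinM.
have optP := dual_optimal_neq0 _ _ _ hb1 slopes_le lt_slopes.
have bar_lt : ((beta 0%N)%:E < betabar)%E -> m = beta 0%N.
  by move=> lt_bar; apply: EFin_inj; rewrite -mE; apply/min_idPl/ltW.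
split; first by split; [exists (u, v)|exists (b1 *: e0 R); rewrite /= primalE].
do 3 split=> //.
split.
  rewrite /duality_gap primal_valueE dual_valueE /ubar mE hc0.
  have -> : (Order.max 0 ((beta 0%N)%:E - betabar) = (beta 0%N - m)%:E)%E.
    have [lt_bar|bar_le] := ltP (beta 0%N)%:E betabar.
      rewrite bar_lt// subrr; apply/max_idPl.
      by rewrite sube_le0 ltW.
    have barE : betabar = m%:E by rewrite -mE min_r.
    rewrite barE -EFinB; apply/max_idPr.
    by rewrite lee_fin subr_ge0 -lee_fin -barE.
  by rewrite -(EFinD u m) -!EFinM -EFinB; congr EFin; ring.
split.
  rewrite mE => -[m0]; rewrite m0 addr0 in slopes_le.
  exact: dual_optimal_slopes.
split.
  move=> _ lt_bar; apply/optP; rewrite bar_lt//; apply/slopesP.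
  by split=> //; exact: lt_liminf_slope.
move=> bar_le _; have barE : betabar = m%:E by rewrite -mE min_r.
under eq_imagel => k _ do rewrite barE -EFinM -EFinB mulrC.
rewrite optP slopesP affine_minorant_fin_num.
by split=> [[]//|fin]; split=> //; rewrite -lee_fin -barE.
Qed.
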